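(* For all integers $m,n\ge0$ and $Z\in\mathbb{BC}$, $$H_{m,n}(Z,Z^* )=(-1)^{m+n}e^{|Z|_{\mathbf{k}}^2}\frac{\partial^{m+n}}{\partial (Z^* )^m\,\partial Z^n}\left(e^{-|Z|_{\mathbf{k}}^2}\right).$$
   Context: Bicomplex numbers: $\mathbb{BC}$ is the commutative real algebra generated by two commuting imaginary units $\mathbf{i},\mathbf{j}$ ($\mathbf{i}^2=\mathbf{j}^2=-1$), with $\mathbf{k}=\mathbf{i}\mathbf{j}$, $\mathbf{k}^2=1$. Put $\mathbf{e}_1=\frac{1+\mathbf{k}}{2}$, $\mathbf{e}_2=\frac{1-\mathbf{k}}{2}$ (idempotents with $\mathbf{e}_1\mathbf{e}_2=0$, $\mathbf{e}_1+\mathbf{e}_2=1$). Each $Z=z_1+\mathbf{j}z_2$ with $z_1,z_2\in\mathbb{C}=\mathbb{C}(\mathbf{i})$ is uniquely $Z=\lambda_1\mathbf{e}_1+\lambda_2\mathbf{e}_2$ with $\lambda_1=z_1-\mathbf{i}z_2$, $\lambda_2=z_1+\mathbf{i}z_2\in\mathbb{C}$. The $*$-conjugate is $Z^*=\overline{z_1}-\mathbf{j}\overline{z_2}=\overline{\lambda_1}\mathbf{e}_1+\overline{\lambda_2}\mathbf{e}_2$, and $|Z|_{\mathbf{k}}^2:=ZZ^*=|\lambda_1|^2\mathbf{e}_1+|\lambda_2|^2\mathbf{e}_2$. The bicomplex exponential is $e^{Z}=e^{\lambda_1}\mathbf{e}_1+e^{\lambda_2}\mathbf{e}_2$ (equivalently,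 its power series). Differential operators: $\frac{\partial}{\partial Z}=\partial_{\lambda_1}\mathbf{e}_1+\partial_{\lambda_2}\mathbf{e}_2$ and $\frac{\partial}{\partial Z^*}=\partial_{\overline{\lambda_1}}\mathbf{e}_1+\partial_{\overline{\lambda_2}}\mathbf{e}_2$, with $\partial_\lambda,\partial_{\overline\lambda}$ the usual Wirtinger derivatives, acting componentwise on smooth $f=f_1\mathbf{e}_1+f_2\mathbf{e}_2$ (with $f_1,f_2$ complex-valued), i.e. $\frac{\partial f}{\partial Z}=(\partial_{\lambda_1}f_1)\mathbf{e}_1+(\partial_{\lambda_2}f_2)\mathbf{e}_2$ and $\frac{\partial f}{\partial Z^*}=(\partial_{\overline{\lambda_1}}f_1)\mathbf{e}_1+(\partial_{\overline{\lambda_2}}f_2)\mathbf{e}_2$. The $Z^*$-bicomplex Hermite polynomials of the first kind are, for integers $m,n\ge0$, $$H_{m,n}(Z,Z^* )=\sum_{k=0}^{\min(m,n)}(-1)^k k!\binom{m}{k}\binom{n}{k}Z^{m-k}(Z^* )^{n-k}.$$ *)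

(* Defs.v *)
From HB Require Import structures.
From mathcomp Require Import all_boot all_order all_algebra.
From mathcomp Require Import all_classical all_reals all_analysis.
From mathcomp Require Import complex.
From mathcomp Require Import ring.

Set Implicit Arguments.
Unset Strict Implicit.
Unset Printing Implicit Defensive.

Import Order.TTheory GRing.Theory Num.Theory.
Import numFieldNormedType.Exports.

Local Open Scope ring_scope.
Local Open Scope complex_scope.

(* [F[i]] adjoins a square root of -1 to any field F, so iterating it gives
   BC: [Complex z1 z2 : R[i][i]] is z1 + j z2, the inner unit being i and the
   outer one j.  BC has zero divisors; only its commutative ring structure is
   used. *)
Definition bicomplex (R : realType) : Type := R[i][i].

HB.instance Definition _ (R : realType) := GRing.ComNzRing.on (bicomplex R).

Section Bicomplex.
Variable R : realType.
Local Notation C := R[i].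
Local Notation BC := (bicomplex R).
Local Notation Re := complex.Re.
Local Notation Im := complex.Im.

Definition bc_of_C (z : C) : BC := Complex z 0.

Definition bc_i : BC := bc_of_C (Complex 0 1).
Definition bc_j : BC := Complex 0 1.
Definition bc_k : BC := bc_i * bc_j.

Definition bc_e1 : BC := bc_of_C 2^-1 * (1 + bc_k).
Definition bc_e2 : BC := bc_of_C 2^-1 * (1 - bc_k).

Definition lambda1 (Z : BC) : C := Re Z - Complex 0 1 * Im Z.
Definition lambda2 (Z : BC) : C := Re Z + Complex 0 1 * Im Z.

Definition of_idem (l1 l2 : C) : BC := bc_of_C l1 * bc_e1 + bc_of_C l2 * bc_e2.

Definition bc_star (Z : BC) : BC :=
  bc_of_C (conjc (Re Z)) - bc_j * bc_of_C (conjc (Im Z)).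

Definition bc_normk2 (Z : BC) : BC := Z * bc_star Z.

Definition Cexp (z : C) : C :=
  Complex (expR (Re z) * cos (Im z)) (expR (Re z) * sin (Im z)).

Definition bc_exp (Z : BC) : BC := of_idem (Cexp (lambda1 Z)) (Cexp (lambda2 Z)).

(* Partial derivatives of g : C -> C in the real coordinates z = x + i y,
   taken on the real and imaginary parts of g. *)
Definition partial_x (g : C -> C) (z : C) : C :=
  Complex (derive1 (fun x : R => Re (g (Complex x (Im z)))) (Re z))
          (derive1 (fun x : R => Im (g (Complex x (Im z)))) (Re z)).

Definition partial_y (g : C -> C) (z : C) : C :=
  Complex (derive1 (fun y : R => Re (g (Complex (Re z) y))) (Im z))
          (derive1 (fun y : R => Im (g (Complex (Re z) y))) (Im z)).

Definition wirtinger (g : C -> C) (z : C) : C :=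
  2^-1 * (partial_x g z - Complex 0 1 * partial_y g z).

Definition wirtinger_bar (g : C -> C) (z : C) : C :=
  2^-1 * (partial_x g z + Complex 0 1 * partial_y g z).

(* Each component f_s = lambda_s \o f depends on both idempotent coordinates
   of Z; it is differentiated in the s-th one, the other being frozen. *)
Definition d_Z (f : BC -> BC) (Z : BC) : BC :=
  of_idem
    (wirtinger (fun l => lambda1 (f (of_idem l (lambda2 Z)))) (lambda1 Z))
    (wirtinger (fun l => lambda2 (f (of_idem (lambda1 Z) l))) (lambda2 Z)).

Definition d_Zstar (f : BC -> BC) (Z : BC) : BC :=
  of_idem
    (wirtinger_bar (fun l => lambda1 (f (of_idem l (lambda2 Z)))) (lambda1 Z))
    (wirtinger_bar (fun l => lambda2 (f (of_idem (lambda1 Z) l))) (lambda2 Z)).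

Definition bc_hermite (m n : nat) (Z W : BC) : BC :=
  \sum_(0 <= k < (minn m n).+1)
    (-1) ^+ k * (k`! * 'C(m, k) * 'C(n, k))%:R * Z ^+ (m - k) * W ^+ (n - k).

Lemma bc_eqP (Z W : BC) : Re Z = Re W -> Im Z = Im W -> Z = W.
Proof. by case: Z W => [a b] [c d] /= -> ->. Qed.

Lemma bc_mulE (a b c d : C) :
  (Complex a b : BC) * (Complex c d : BC)
  = Complex (a * c - b * d) (a * d + b * c).
Proof. by []. Qed.

Lemma bc_addE (a b c d : C) :
  (Complex a b : BC) + (Complex c d : BC) = Complex (a + c) (b + d).
Proof. by []. Qed.

Lemma bc_oppE (a b : C) : - (Complex a b : BC) = Complex (- a) (- b).
Proof. by []. Qed.

Lemma bc_1E : (1 : BC) = Complex 1 0. Proof. by []. Qed.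

Lemma C_ii : (Complex 0 1 : C) * Complex 0 1 = -1.
Proof. by rewrite -expr2 sqr_i. Qed.

Lemma bc_iiE : bc_i * bc_i = -1.
Proof.
by rewrite bc_mulE C_ii !mulr0 !mul0r subr0 addr0 bc_1E bc_oppE oppr0.
Qed.

Lemma bc_jjE : bc_j * bc_j = -1.
Proof.
by rewrite bc_mulE !mulr0 !mul0r !mulr1 sub0r addr0 bc_1E bc_oppE oppr0.
Qed.

Lemma bc_kkE : bc_k * bc_k = 1.
Proof. by rewrite /bc_k mulrACA bc_iiE bc_jjE mulrNN mulr1. Qed.

Lemma bc_kE : bc_k = Complex 0 (Complex 0 1).
Proof.
by rewrite /bc_k bc_mulE !mulr0 !mul0r mulr1 subr0 addr0.
Qed.

Lemma bc_e1E : bc_e1 = Complex 2^-1 (2^-1 * Complex 0 1).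
Proof.
rewrite /bc_e1 bc_kE bc_1E bc_addE addr0 add0r /bc_of_C bc_mulE.
by congr Complex; rewrite !(mulr0, mul0r, mulr1, subr0, addr0, add0r).
Qed.

Lemma bc_e2E : bc_e2 = Complex 2^-1 (- (2^-1 * Complex 0 1)).
Proof.
rewrite /bc_e2 bc_kE bc_1E bc_oppE bc_addE oppr0 addr0 add0r /bc_of_C bc_mulE.
by congr Complex;
  rewrite !(mulr0, mul0r, mulr1, subr0, oppr0, addr0, add0r, mulrN).
Qed.

Lemma of_idemE (l1 l2 : C) :
  of_idem l1 l2
  = Complex (2^-1 * (l1 + l2)) (2^-1 * Complex 0 1 * (l1 - l2)).
Proof.
rewrite /of_idem bc_e1E bc_e2E /bc_of_C !bc_mulE bc_addE.
by congr Complex; ring.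
Qed.

Lemma bc_starE (Z : BC) : bc_star Z = Complex (conjc (Re Z)) (- conjc (Im Z)).
Proof.
rewrite /bc_star /bc_j /bc_of_C bc_mulE bc_oppE bc_addE.
by congr Complex; ring.
Qed.

Lemma half_double (x : C) : 2^-1 * (x + x) = x.
Proof.
have -> : x + x = 2 * x by ring.
by rewrite mulKf // pnatr_eq0.
Qed.

Lemma lambda1_of_idem (l1 l2 : C) : lambda1 (of_idem l1 l2) = l1.
Proof.
rewrite of_idemE /lambda1 /= -!mulrA mulrCA (mulrA (Complex 0 1)) C_ii.
by rewrite -mulrBr -[RHS]half_double; congr (_ * _); ring.
Qed.

Lemma lambda2_of_idem (l1 l2 : C) : lambda2 (of_idem l1 l2) = l2.
Proof.
rewrite of_idemE /lambda2 /= -!mulrA mulrCA (mulrA (Complex 0 1)) C_ii.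
by rewrite -mulrDr -[RHS]half_double; congr (_ * _); ring.
Qed.

Lemma of_idem_lambda (Z : BC) : of_idem (lambda1 Z) (lambda2 Z) = Z.
Proof.
case: Z => a b; rewrite of_idemE /lambda1 /lambda2 /=; congr Complex.
  by rewrite -[RHS]half_double; congr (_ * _); ring.
rewrite -mulrA -[RHS]half_double; congr (_ * _).
set u : C := Complex 0 1.
have -> : u * (a - u * b - (a + u * b)) = - (u * u) * (b + b) by ring.
by rewrite C_ii opprK mul1r.
Qed.

Lemma lambda1M (Z W : BC) : lambda1 (Z * W) = lambda1 Z * lambda1 W.
Proof.
case: Z W => [a b] [c d]; rewrite bc_mulE /lambda1 /=.
set u : C := Complex 0 1.
have -> : (a - u * b) * (c - u * d)
  = a * c + (u * u) * (b * d) - u * (a * d + b * c) by ring.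
by rewrite C_ii mulN1r.
Qed.

Lemma lambda2M (Z W : BC) : lambda2 (Z * W) = lambda2 Z * lambda2 W.
Proof.
case: Z W => [a b] [c d]; rewrite bc_mulE /lambda2 /=.
set u : C := Complex 0 1.
have -> : (a + u * b) * (c + u * d)
  = a * c + (u * u) * (b * d) + u * (a * d + b * c) by ring.
by rewrite C_ii mulN1r.
Qed.

Lemma lambda1_star (Z : BC) : lambda1 (bc_star Z) = conjc (lambda1 Z).
Proof.
case: Z => [[a b] [c d]]; rewrite bc_starE /lambda1 /=.
by apply/eqP; rewrite eq_complex /=; apply/andP; split; apply/eqP; ring.
Qed.

Lemma lambda2_star (Z : BC) : lambda2 (bc_star Z) = conjc (lambda2 Z).
Proof.
case: Z => [[a b] [c d]]; rewrite bc_starE /lambda2 /=.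
by apply/eqP; rewrite eq_complex /=; apply/andP; split; apply/eqP; ring.
Qed.

End Bicomplex.

(* Main.v *)
Require Import Defs.
From HB Require Import structures.
From mathcomp Require Import all_boot all_order all_algebra.
From mathcomp Require Import all_classical all_reals all_analysis.
From mathcomp Require Import complex ring.

(** Both sides split along the idempotents.  The function
    [W |-> exp (- |W|_k^2)] is [idem_map gauss gauss], where
    [gauss z = exp (- z * conj z)] on the complex plane, and the bicomplex
    operators send [idem_map g1 g2] to the [idem_map] of the Wirtinger
    derivatives of [g1] and [g2]; as [lambda1] and [lambda2] are jointly
    injective ring morphisms, it suffices to prove the Rodrigues formula for
    one complex variable.

    There, each [d/dz] brings down a factor [- conj z] and acts on nothing
    else, so the [n]-th one is [(-1)^n (conj z)^n gauss].  Now [d/dzbar] maps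
    [p * gauss] to [- (z p - dp/dzbar) * gauss], and [z] is a constant for
    [d/dzbar].  Hence the [m]-th derivative is, up to sign,
    [(z - d/dw)^m w^n] at [w = conj z], times [gauss].  The binomial theorem
    for the commuting operators [z] and [d/dw] turns it into the Hermite sum.
    In the induction on [m], Pascal's rule ([binomial_sumS]) does this step by
    step, and [wirtinger_bar_hermite] computes the derivative.

    Derivatives are handled through the relation [has_wirtinger], which
    contains the existence of the real partial derivatives and is closed under
    the ring operations and the exponential. *)

Set Implicit Arguments.
Unset Strict Implicit.
Unset Printing Implicit Defensive.

Import Order.TTheory GRing.Theory Num.Theory.
Import numFieldNormedType.Exports.

Local Open Scope ring_scope.
Local Open Scope complex_scope.

(** * Hermite sums over a commutative ring *)

Section HermiteSums.
Variable A : comNzRingType.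
Implicit Types x y : A.

Definition hermite_sum m n x y : A :=
  \sum_(0 <= k < (minn m n).+1)
    (-1) ^+ k * (k`! * 'C(m, k) * 'C(n, k))%:R * x ^+ (m - k) * y ^+ (n - k).

(** The umbral form of [(x + u)^m], with [u k] in place of the [k]-th power of
    [u].  It is used for the expansion of [(x - d/dy)^m], applied to [y^n]. *)
Definition binomial_sum x m (u : nat -> A) : A :=
  \sum_(k < m.+1) 'C(m, k)%:R * x ^+ (m - k) * u k.

(** [(- d/dy)^k] applied to [y^n]. *)
Definition signed_derivs n y k : A := (-1) ^+ k * (n ^_ k)%:R * y ^+ (n - k).

(** The factor [k! 'C(n, k)] is a falling factorial, as in the [k]-th derivative
    of [y^n]; the terms with [min m n < k <= m] vanish since then
    [n < k]. *)
Lemma hermite_sumE m n x y :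
  hermite_sum m n x y = binomial_sum x m (signed_derivs n y).
Proof.
rewrite /hermite_sum /binomial_sum big_mkord.
rewrite -(big_mkord xpredT
  (fun k => 'C(m, k)%:R * x ^+ (m - k) * signed_derivs n y k)).
rewrite (big_cat_nat (n := (minn m n).+1)) //=; last by rewrite ltnS geq_minl.
rewrite [X in _ + X]big_nat_cond [X in _ + X]big1 => [|k]; last first.
  rewrite andbT => /andP[lo hi].
  have nk : (n < k)%N by move: lo; rewrite gtn_min ltnNge -ltnS hi.
  by rewrite /signed_derivs ffact_small // mulr0 mul0r mulr0.
rewrite addr0 big_mkord; apply: eq_bigr => k _.
by rewrite /signed_derivs -bin_ffact !natrM; ring.
Qed.

(** [(x + u)^(m+1) = x (x + u)^m + u (x + u)^m], read umbrally: the product with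
    [u] is the shift of the sequence. *)
Lemma binomial_sumS x m u :
  binomial_sum x m.+1 u
  = x * binomial_sum x m u + binomial_sum x m (fun k => u k.+1).
Proof.
rewrite /binomial_sum big_ord_recl /=.
under eq_bigr => k _.
  rewrite /bump /= add1n binS natrD subSS !mulrDl.
  over.
rewrite big_split /= addrA; congr (_ + _).
rewrite big_ord_recr /= (@bin_small m m.+1) // !mul0r addr0.
rewrite [in RHS]big_ord_recl !bin0 !subn0 mulrDr mulr_sumr exprS.
congr (_ + _); first by ring.
apply: eq_bigr => k _; rewrite lift0 subnS.
have km : (0 < m - k)%N by rewrite subn_gt0.
by rewrite -[in LHS](prednK km) exprS; ring.
Qed.

End HermiteSums.

(** * Calculus of Wirtinger derivatives *)

Section Wirtinger.
Variable R : realType.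
Local Notation C := R[i].
Local Notation Re := complex.Re.
Local Notation Im := complex.Im.
Local Notation I := (Complex 0 1 : C).

Definition curve_deriv (c : R -> C) (t : R) (d : C) : Prop :=
  is_derive t 1 (fun s => Re (c s)) (Re d) /\
  is_derive t 1 (fun s => Im (c s)) (Im d).

Lemma curve_deriv_cst (a : C) t : curve_deriv (fun=> a) t 0.
Proof. by split; apply: is_derive_cst. Qed.

Lemma curve_derivD c1 c2 t d1 d2 :
  curve_deriv c1 t d1 -> curve_deriv c2 t d2 ->
  curve_deriv (fun s => c1 s + c2 s) t (d1 + d2).
Proof.
move=> [a1 b1] [a2 b2]; split.
- have -> : (fun s => Re (c1 s + c2 s)) =
      (fun s => Re (c1 s)) + (fun s => Re (c2 s)).
    by apply: funext => s; rewrite /= raddfD.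
  by rewrite raddfD; apply: is_deriveD.
- have -> : (fun s => Im (c1 s + c2 s)) =
      (fun s => Im (c1 s)) + (fun s => Im (c2 s)).
    by apply: funext => s; rewrite /= raddfD.
  by rewrite raddfD; apply: is_deriveD.
Qed.

Lemma curve_derivM c1 c2 t d1 d2 :
  curve_deriv c1 t d1 -> curve_deriv c2 t d2 ->
  curve_deriv (fun s => c1 s * c2 s) t (d1 * c2 t + c1 t * d2).
Proof.
move=> [a1 b1] [a2 b2]; split.
- have -> : (fun s => Re (c1 s * c2 s)) =
      (fun s => Re (c1 s)) * (fun s => Re (c2 s))
      - (fun s => Im (c1 s)) * (fun s => Im (c2 s)).
    apply: funext => s; rewrite -[RHS]/(_ * _ - _ * _).
    by case: (c1 s) (c2 s) => ? ? [].
  apply: (is_derive_eq (is_deriveB (is_deriveM a1 a2) (is_deriveM b1 b2))).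
  rewrite /GRing.scale /=.
  by case: (c1 t) (c2 t) d1 d2 {a1 b1 a2 b2} => ? ? [? ?] [? ?] [? ?] /=; ring.
- have -> : (fun s => Im (c1 s * c2 s)) =
      (fun s => Re (c1 s)) * (fun s => Im (c2 s))
      + (fun s => Im (c1 s)) * (fun s => Re (c2 s)).
    apply: funext => s; rewrite -[RHS]/(_ * _ + _ * _).
    by case: (c1 s) (c2 s) => ? ? [].
  apply: (is_derive_eq (is_deriveD (is_deriveM a1 b2) (is_deriveM b1 a2))).
  rewrite /GRing.scale /=.
  by case: (c1 t) (c2 t) d1 d2 {a1 b1 a2 b2} => ? ? [? ?] [? ?] [? ?] /=; ring.
Qed.

Lemma curve_deriv_Cexp c t d :
  curve_deriv c t d -> curve_deriv (fun s => Cexp (c s)) t (d * Cexp (c t)).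
Proof.
move=> [a b].
have e : is_derive t 1 (fun s => expR (Re (c s))) (expR (Re (c t)) * Re d).
  exact: is_derive1_comp.
have co : is_derive t 1 (fun s => cos (Im (c s))) (- sin (Im (c t)) * Im d).
  exact: is_derive1_comp.
have si : is_derive t 1 (fun s => sin (Im (c s))) (cos (Im (c t)) * Im d).
  exact: is_derive1_comp.
split; rewrite /Cexp /=.
- apply: (is_derive_eq (is_deriveM e co)); rewrite /GRing.scale /=.
  by case: d {a b e co si} => ? ? /=; ring.
- apply: (is_derive_eq (is_deriveM e si)); rewrite /GRing.scale /=.
  by case: d {a b e co si} => ? ? /=; ring.
Qed.

(** [g] has real partial derivatives at [z], and [a], [b] are its values of
    [d/dz], [d/dzbar]; the real partials are [a + b] and [i (a - b)].  Only
    existence of partials along the two axes is asked, which is what [wirtinger]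
    evaluates and is enough for the rules below: they are rules for curves,
    applied on each axis. *)
Definition has_wirtinger (g : C -> C) (z a b : C) : Prop :=
  curve_deriv (fun x => g (Complex x (Im z))) (Re z) (a + b) /\
  curve_deriv (fun y => g (Complex (Re z) y)) (Im z) (I * (a - b)).

Lemma has_wirtinger_eq g z a b a' b' :
  has_wirtinger g z a b -> a = a' -> b = b' -> has_wirtinger g z a' b'.
Proof. by move=> + <- <-. Qed.

Lemma has_wirtinger_partials g z a b :
  has_wirtinger g z a b ->
  partial_x g z = a + b /\ partial_y g z = I * (a - b).
Proof.
move=> [[? ?] [? ?]]; rewrite /partial_x /partial_y !derive1E !derive_val.
by split; apply/eqP; rewrite eq_complex /= !eqxx.
Qed.

Lemma wirtingerE g z a b : has_wirtinger g z a b -> wirtinger g z = a.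
Proof.
move=> /has_wirtinger_partials[px py]; rewrite /wirtinger px py mulrA C_ii.
by rewrite -[RHS]Defs.half_double; congr (_ * _); ring.
Qed.

Lemma wirtinger_barE g z a b : has_wirtinger g z a b -> wirtinger_bar g z = b.
Proof.
move=> /has_wirtinger_partials[px py]; rewrite /wirtinger_bar px py mulrA C_ii.
by rewrite -[RHS]Defs.half_double; congr (_ * _); ring.
Qed.

Lemma has_wirtinger_cst (a z : C) : has_wirtinger (fun=> a) z 0 0.
Proof. by split; rewrite ?subrr ?mulr0 ?addr0; apply: curve_deriv_cst. Qed.

Lemma has_wirtinger_id z : has_wirtinger id z 1 0.
Proof.
split; rewrite ?subr0 ?addr0 ?mulr1; split=> /=;
  by [apply: is_derive_id | apply: is_derive_cst].
Qed.

Lemma has_wirtinger_conj z : has_wirtinger (@conjc R) z 0 1.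
Proof.
split; rewrite ?sub0r ?add0r ?mulrN1; split=> /=; rewrite ?oppr0;
  try by [apply: is_derive_id | apply: is_derive_cst].
exact: is_deriveN.
Qed.

Lemma has_wirtingerD g1 g2 z a1 b1 a2 b2 :
  has_wirtinger g1 z a1 b1 -> has_wirtinger g2 z a2 b2 ->
  has_wirtinger (fun l => g1 l + g2 l) z (a1 + a2) (b1 + b2).
Proof.
move=> [x1 y1] [x2 y2]; split.
  by rewrite addrACA; apply: curve_derivD.
by rewrite opprD addrACA mulrDr; apply: curve_derivD.
Qed.

Lemma has_wirtingerM g1 g2 z a1 b1 a2 b2 :
  has_wirtinger g1 z a1 b1 -> has_wirtinger g2 z a2 b2 ->
  has_wirtinger (fun l => g1 l * g2 l) z
    (a1 * g2 z + g1 z * a2) (b1 * g2 z + g1 z * b2).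
Proof.
have zE : Complex (Re z) (Im z) = z by case: z.
move=> [x1 y1] [x2 y2]; split.
  have := curve_derivM x1 x2; rewrite zE; congr curve_deriv; ring.
have := curve_derivM y1 y2; rewrite zE; congr curve_deriv; ring.
Qed.

Lemma has_wirtinger_Cexp g z a b :
  has_wirtinger g z a b ->
  has_wirtinger (fun l => Cexp (g l)) z (a * Cexp (g z)) (b * Cexp (g z)).
Proof.
have zE : Complex (Re z) (Im z) = z by case: z.
move=> [x y]; split.
  by have := curve_deriv_Cexp x; rewrite zE mulrDl.
by have := curve_deriv_Cexp y; rewrite zE -mulrA mulrBl.
Qed.

Lemma has_wirtingerX g z a b n :
  has_wirtinger g z a b ->
  has_wirtinger (fun l => g l ^+ n) z
    (n%:R * g z ^+ n.-1 * a) (n%:R * g z ^+ n.-1 * b).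
Proof.
move=> gz; elim: n => [|n IH].
  by rewrite !mul0r; apply: has_wirtinger_cst.
have -> : (fun l => g l ^+ n.+1) = (fun l => g l * g l ^+ n).
  by apply: funext => l; rewrite exprS.
have gn : n%:R * g z ^+ n = n%:R * (g z * g z ^+ n.-1).
  by case: n {IH} => [|n]; rewrite ?mul0r // -exprS.
apply: has_wirtinger_eq (has_wirtingerM gz IH) _ _;
  rewrite -[n.+1.-1]/n -natr1 !mulrDl gn; ring.
Qed.

Lemma has_wirtinger_sum N (F : nat -> C -> C) z (a b : nat -> C) :
  (forall k, has_wirtinger (F k) z (a k) (b k)) ->
  has_wirtinger (fun l => \sum_(k < N) F k l) z
    (\sum_(k < N) a k) (\sum_(k < N) b k).
Proof.
move=> H; elim: N => [|N IH].
  rewrite !big_ord0; under eq_fun do rewrite big_ord0.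
  exact: has_wirtinger_cst.
rewrite !big_ord_recr /=; under eq_fun do rewrite big_ord_recr /=.
exact: has_wirtingerD.
Qed.

(** * The Rodrigues formula in one complex variable *)

Definition gauss (z : C) : C := Cexp (- (z * conjc z)).

Lemma has_wirtinger_gauss z :
  has_wirtinger gauss z (- conjc z * gauss z) (- z * gauss z).
Proof.
have H := has_wirtingerM (has_wirtinger_id z) (has_wirtinger_conj z).
have {}H := has_wirtingerM (has_wirtinger_cst (-1) z) H.
have -> : gauss = (fun l => Cexp (-1 * (l * conjc l))).
  by apply: funext => l; rewrite mulN1r.
by apply: has_wirtinger_eq (has_wirtinger_Cexp H) _ _; congr (_ * _); ring.
Qed.

Lemma iter_wirtinger_gauss n :
  iter n (@wirtinger R) gauss = fun z => (-1) ^+ n * conjc z ^+ n * gauss z.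
Proof.
elim: n => [|n /= ->]; first by apply: funext => z; rewrite !mul1r.
apply: funext => z.
have H := has_wirtingerX n (has_wirtinger_conj z).
have {}H := has_wirtingerM (has_wirtinger_cst ((-1) ^+ n) z) H.
by rewrite (wirtingerE (has_wirtingerM H (has_wirtinger_gauss z))) !exprS; ring.
Qed.

(** Each monomial of the Hermite sum differentiates in [conj z] to minus the one
    with [signed_derivs] shifted, since [(n)_k (n - k) = (n)_(k+1)].  With the
    term [- z * gauss] of the Gaussian this is the recursion [binomial_sumS]. *)
Lemma wirtinger_bar_hermite m n (s : C) :
  wirtinger_bar (fun z => s * hermite_sum m n z (conjc z) * gauss z)
  = fun z => - s * hermite_sum m.+1 n z (conjc z) * gauss z.
Proof.
apply: funext => z.
pose F k (l : C) := 'C(m, k)%:R * l ^+ (m - k) * signed_derivs n (conjc l) k.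
(* [d/dz] of each monomial is left existential: [wirtinger_bar] reads off only
   the second component. *)
have HF k : exists a, has_wirtinger (F k) z a
    (- ('C(m, k)%:R * z ^+ (m - k) * signed_derivs n (conjc z) k.+1)).
  have P := has_wirtingerM (has_wirtinger_cst 'C(m, k)%:R z)
    (has_wirtingerX (m - k) (has_wirtinger_id z)).
  have Q := has_wirtingerM (has_wirtinger_cst ((-1) ^+ k * (n ^_ k)%:R) z)
    (has_wirtingerX (n - k) (has_wirtinger_conj z)).
  eexists; apply: has_wirtinger_eq (has_wirtingerM P Q) erefl _.
  by rewrite /signed_derivs ffactnSr natrM subnS exprS; ring.
have [a Ha] := choice HF.
have H : has_wirtinger (fun l => hermite_sum m n l (conjc l)) z
    (\sum_(k < m.+1) a k)
    (- binomial_sum z m (fun k => signed_derivs n (conjc z) k.+1)).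
  under eq_fun do rewrite hermite_sumE.
  rewrite /binomial_sum -sumrN.
  have Hsum := has_wirtinger_sum m.+1 Ha.
  exact: Hsum.
have {}H := has_wirtingerM (has_wirtinger_cst s z) H.
rewrite (wirtinger_barE (has_wirtingerM H (has_wirtinger_gauss z))).
by rewrite !hermite_sumE binomial_sumS; ring.
Qed.

Lemma rodrigues m n :
  iter m (@wirtinger_bar R) (iter n (@wirtinger R) gauss)
  = fun z => (-1) ^+ (m + n) * hermite_sum m n z (conjc z) * gauss z.
Proof.
elim: m => [|m /= ->].
  rewrite iter_wirtinger_gauss; apply: funext => z; congr (_ * _ * _).
  by rewrite /hermite_sum min0n big_nat1 !bin0 !subn0 !mul1r.
rewrite wirtinger_bar_hermite; apply: funext => z.
by rewrite addSn exprS mulN1r.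
Qed.

Lemma CexpNK (a : C) : Cexp a * Cexp (- a) = 1.
Proof.
case: a => x y; rewrite /Cexp /= expRN cosN sinN.
have ex : expR x * (expR x)^-1 = 1 by rewrite divff // gt_eqF ?expR_gt0.
have cs := cos2Dsin2 y.
apply/eqP; rewrite eq_complex /=; apply/andP; split; apply/eqP; last by ring.
transitivity ((expR x * (expR x)^-1) * (cos y ^+ 2 + sin y ^+ 2)).
  by ring.
by rewrite ex cs mulr1.
Qed.

End Wirtinger.

(** * Reduction to the idempotent components *)

Section Idempotent.
Variable R : realType.
Local Notation C := R[i].
Local Notation BC := (bicomplex R).

Lemma lambda1_zmod_morphism : zmod_morphism (@lambda1 R).
Proof. by move=> [a b] [c d]; rewrite bc_oppE bc_addE /lambda1 /=; ring. Qed.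

Lemma lambda2_zmod_morphism : zmod_morphism (@lambda2 R).
Proof. by move=> [a b] [c d]; rewrite bc_oppE bc_addE /lambda2 /=; ring. Qed.

Lemma lambda1_monoid_morphism : monoid_morphism (@lambda1 R).
Proof. by split; [rewrite /lambda1 /= mulr0 subr0 | exact: lambda1M]. Qed.

Lemma lambda2_monoid_morphism : monoid_morphism (@lambda2 R).
Proof. by split; [rewrite /lambda2 /= mulr0 addr0 | exact: lambda2M]. Qed.

HB.instance Definition _ :=
  GRing.isZmodMorphism.Build BC C (@lambda1 R) lambda1_zmod_morphism.
HB.instance Definition _ :=
  GRing.isZmodMorphism.Build BC C (@lambda2 R) lambda2_zmod_morphism.
HB.instance Definition _ :=
  GRing.isMonoidMorphism.Build BC C (@lambda1 R) lambda1_monoid_morphism.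
HB.instance Definition _ :=
  GRing.isMonoidMorphism.Build BC C (@lambda2 R) lambda2_monoid_morphism.

Lemma rmorph_hermite (phi : {rmorphism BC -> C}) m n (Z W : BC) :
  phi (bc_hermite m n Z W) = hermite_sum m n (phi Z) (phi W).
Proof.
rewrite rmorph_sum; apply: eq_bigr => k _.
by rewrite !rmorphM !rmorphXn rmorphN rmorph1 /= !rmorph_nat.
Qed.

Definition idem_map (g1 g2 : C -> C) (Z : BC) : BC :=
  of_idem (g1 (lambda1 Z)) (g2 (lambda2 Z)).

Lemma lambda1_idem_map g1 g2 l1 l2 :
  lambda1 (idem_map g1 g2 (of_idem l1 l2)) = g1 l1.
Proof. by rewrite /idem_map !lambda1_of_idem. Qed.

Lemma lambda2_idem_map g1 g2 l1 l2 :
  lambda2 (idem_map g1 g2 (of_idem l1 l2)) = g2 l2.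
Proof. by rewrite /idem_map !lambda2_of_idem. Qed.

(** The [s]-th component of [idem_map g1 g2] depends on the [s]-th coordinate
    alone, so freezing the other coordinate in [d_Z] has no effect. *)
Lemma d_Z_idem_map g1 g2 :
  d_Z (idem_map g1 g2) = idem_map (wirtinger g1) (wirtinger g2).
Proof.
apply: funext => Z; rewrite /d_Z.
rewrite (funext (fun l => lambda1_idem_map g1 g2 l (lambda2 Z))).
by rewrite (funext (fun l => lambda2_idem_map g1 g2 (lambda1 Z) l)).
Qed.

Lemma d_Zstar_idem_map g1 g2 :
  d_Zstar (idem_map g1 g2) = idem_map (wirtinger_bar g1) (wirtinger_bar g2).
Proof.
apply: funext => Z; rewrite /d_Zstar.
rewrite (funext (fun l => lambda1_idem_map g1 g2 l (lambda2 Z))).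
by rewrite (funext (fun l => lambda2_idem_map g1 g2 (lambda1 Z) l)).
Qed.

Lemma iter_d_Z_idem_map n g1 g2 :
  iter n (@d_Z R) (idem_map g1 g2)
  = idem_map (iter n (@wirtinger R) g1) (iter n (@wirtinger R) g2).
Proof. by elim: n => //= n ->; rewrite d_Z_idem_map. Qed.

Lemma iter_d_Zstar_idem_map n g1 g2 :
  iter n (@d_Zstar R) (idem_map g1 g2)
  = idem_map (iter n (@wirtinger_bar R) g1) (iter n (@wirtinger_bar R) g2).
Proof. by elim: n => //= n ->; rewrite d_Zstar_idem_map. Qed.

Lemma bc_gauss_idem_map :
  (fun W : BC => bc_exp (- bc_normk2 W)) = idem_map (@gauss R) (@gauss R).
Proof.
apply: funext => W; rewrite /bc_exp /idem_map /gauss /bc_normk2 !raddfN /=.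
by rewrite lambda1M lambda2M lambda1_star lambda2_star.
Qed.

Lemma lambda_inj (Z W : BC) :
  lambda1 Z = lambda1 W -> lambda2 Z = lambda2 W -> Z = W.
Proof. by move=> h1 h2; rewrite -(of_idem_lambda Z) h1 h2 of_idem_lambda. Qed.

End Idempotent.

Theorem theorem5p6 (R : realType) (m n : nat) (Z : bicomplex R) :
  bc_hermite m n Z (bc_star Z)
  = (-1) ^+ (m + n) * bc_exp (bc_normk2 Z)
    * iter m (@d_Zstar R) (iter n (@d_Z R) (fun W => bc_exp (- bc_normk2 W))) Z.
Proof.
rewrite bc_gauss_idem_map iter_d_Z_idem_map iter_d_Zstar_idem_map !rodrigues.
have cancel (h l : R[i]) :
    h = (-1) ^+ (m + n) * Cexp (l * conjc l) * ((-1) ^+ (m + n) * h * gauss l).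
  by rewrite mulrACA signrMK /gauss CexpNK mulr1.
apply: lambda_inj.
- rewrite (rmorph_hermite (@lambda1 R)) !rmorphM rmorphXn rmorphN rmorph1 /=.
  by rewrite !lambda1_of_idem lambda1M lambda1_star -cancel.
- rewrite (rmorph_hermite (@lambda2 R)) !rmorphM rmorphXn rmorphN rmorph1 /=.
  by rewrite !lambda2_of_idem lambda2M lambda2_star -cancel.
Qed.
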